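(* Let $n\in\mathbb{N}$, let $r_1,r_2,\ldots,r_n>0$ be positive real numbers, let $[a,b]$ be a non-degenerate compact interval, and let $w:[a,b]\to[0,\infty)$ be an upper semicontinuous, non-negative weight function which assumes non-zero values at at least $n$ interior points of $[a,b]$ and, in addition, at at least one more point of $[a,b]$. Let $\|\cdot\|$ denote the sup norm over $[a,b]$. Then there exists a unique extremizer set of points $a\le x_1^*\le\ldots\le x_n^*\le b$ such that \[ \left\|w(x)\,|x-x_1^*|^{r_1}\cdots|x-x_n^*|^{r_n}\right\|=\inf_{a\le x_1\le\ldots\le x_n\le b}\left\|w(x)\,|x-x_1|^{r_1}\cdots|x-x_n|^{r_n}\right\|, \] and in fact $a<x_1^*<\ldots<x_n^*<b$. Moreover, the extremal generalized polynomial $T(x):=\prod_{i=1}^n|x-x_i^*|^{r_i}$ is uniquely determined by the following equioscillation property (that is, $x_1^*,\dots,x_n^*$ has this property, and it is the only system of points $a\le x_1^*\le\ldots\le x_n^*\le b$ having it): there exist points $(t_i)_{i=0}^n$ interlacing with the $x_i^*$, i.e. $a\le t_0<x_1^*<t_1<x_2^*<\ldots<x_n^*<t_n\le b$, such that \[ w(t_k)T(t_k)=\|wT\|\qquad(k=0,1,\ldots,n). \] *)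

(* Defs.v *)
From mathcomp Require Import all_boot all_order all_algebra.
From mathcomp Require Import all_classical all_reals all_analysis.
Set Implicit Arguments.
Unset Strict Implicit.
Unset Printing Implicit Defensive.
Import Order.TTheory GRing.Theory Num.Theory.
Import numFieldNormedType.Exports.
Local Open Scope classical_set_scope.
Local Open Scope ring_scope.

Section Minimax.
Variables (R : realType).

(* Semicontinuity relative to A: the values of w outside A are irrelevant. *)
Definition usc_on (A : set R) (w : R -> R) : Prop :=
  forall u, A u -> forall c, w u < c ->
    \forall v \near within A (nbhs u), w v < c.

(* Taken in \bar R so that no boundedness assumption is built in. *)
Definition sup_norm (a b : R) (f : R -> R) : \bar R :=
  ereal_sup [set `|f u|%:E | u in `[a, b]].

(* [powR 0 s = 0] for s != 0, so the factors vanish at the nodes. *)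
Definition gpoly (n : nat) (r x : 'I_n -> R) (u : R) : R :=
  \prod_(i < n) `|u - x i| `^ r i.

Definition wnorm (n : nat) (r : 'I_n -> R) (a b : R) (w : R -> R)
    (x : 'I_n -> R) : \bar R :=
  sup_norm a b (fun u => w u * gpoly r x u).

Definition node_systems (n : nat) (a b : R) : set ('I_n -> R) :=
  [set x | (forall i, a <= x i <= b) /\
           (forall i j : 'I_n, (i <= j)%N -> x i <= x j)].

Definition strict_nodes (n : nat) (a b : R) (x : 'I_n -> R) : Prop :=
  (forall i, a < x i < b) /\ (forall i j : 'I_n, (i < j)%N -> x i < x j).

Definition extremizer (n : nat) (r : 'I_n -> R) (a b : R) (w : R -> R)
    (x : 'I_n -> R) : Prop :=
  node_systems a b x /\
  wnorm r a b w x = ereal_inf [set wnorm r a b w y | y in node_systems a b].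

(* The nodes x_1, ..., x_n are indexed from 0, so the i-th one lies between
   t_i = [t (widen_ord _ i)] and t_{i+1} = [t (lift ord0 i)]. *)
Definition interlacing (n : nat) (a b : R) (x : 'I_n -> R)
    (t : 'I_n.+1 -> R) : Prop :=
  [/\ a <= t ord0, t ord_max <= b &
      forall i : 'I_n, t (widen_ord (leqnSn n) i) < x i < t (lift ord0 i)].

Definition equioscillates (n : nat) (r : 'I_n -> R) (a b : R) (w : R -> R)
    (x : 'I_n -> R) : Prop :=
  exists t : 'I_n.+1 -> R, interlacing a b x t /\
    forall k, (w (t k) * gpoly r x (t k))%:E = wnorm r a b w x.

(* The interior points z_i and the additional point z0 are pairwise distinct. *)
Definition enough_nonzeros (n : nat) (a b : R) (w : R -> R) : Prop :=
  exists (z : 'I_n -> R) (z0 : R),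
    [/\ injective z,
        forall i, a < z i < b /\ w (z i) != 0,
        a <= z0 <= b /\ w z0 != 0 &
        forall i, z i != z0].

End Minimax.

(* Main.v *)
Require Import Defs.
From mathcomp Require Import all_boot all_order all_algebra.
From mathcomp Require Import all_classical all_reals all_analysis.
From mathcomp Require Import ring lra zify.
Set Implicit Arguments.
Unset Strict Implicit.
Unset Printing Implicit Defensive.
Import Order.TTheory GRing.Theory Num.Theory.
Import numFieldNormedType.Exports.
Local Open Scope classical_set_scope.
Local Open Scope ring_scope.

(** Write T_x for the generalized polynomial with nodes x.  Everything rests on
one tangent inequality ([gpoly_lt_tangent]): when each node moves without
crossing u, the bound ln (1 + z) <= z shows that T(u) strictly decreases as
soon as the first-order variation of ln T(u) is nonpositive.  It is used in two
ways.

Minimizers equioscillate ([extremizer_gap]).  A minimizer x exists by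
compactness, since the norm is lower semicontinuous in x.  Suppose that w T_x
does not reach its norm M > 0 in some gap between consecutive nodes (or between
an endpoint of [a, b] and the extreme node).  Push the nodes at the left end of
the gap to the left and those at the right end to the right, at speeds such
that the two clusters, at positions c <= c', contribute 1 / (u - c) and
-1 / (u - c') to the variation.  At every point u outside the gap the variation
of ln T(u) is then nonpositive, so T(u) decreases.  By upper semicontinuity and
compactness a small push makes w T < M on the whole of [a, b]; clamping the
nodes back to [a, b] does not increase T there, and x was not a minimizer.
Hence w T_x = M somewhere in each of the n + 1 gaps, all of which are therefore
nonempty: the nodes are strictly increasing and interior.

Equioscillation determines the nodes ([gpoly_le_eq]).  Suppose that the points
t_k are interlaced with y and that T_x(t_k) <= T_y(t_k) for all k; the claim is
x = y.  If x is also interlaced with t, Lagrange interpolation gives weights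
c_k > 0 with sum_k c_k / (t_k - x_i) = 0 for every i ([separates_weights]).
The c-average of the first-order variations from x to y vanishes, so one of
them is nonpositive, and there T_y(t_k) < T_x(t_k) unless x = y
([gpoly_lt_separates]).  If x is an arbitrary node system, apply the first part
of the proof to the weight that equals 1 / T_y on the points t_k and 0
elsewhere.  Its minimizers can only equioscillate at the points t_k, so they
are interlaced with t and hence equal to y by the previous case; and x is a
minimizer because its norm is at most that of y.

Finally, if y equioscillates at t and the norm for x is at most the norm for y,
then w(t_k) T_x(t_k) <= w(t_k) T_y(t_k) with w(t_k) > 0, so x = y
([equioscillates_eq]).  Both uniqueness claims follow. *)

(** * The tangent inequality *)

Section Gpoly.
Variables (R : realType) (n : nat).
Implicit Types (r x y : 'I_n -> R) (u : R).

Lemma gpoly_ge0 r x u : 0 <= gpoly r x u.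
Proof. by apply: prodr_ge0 => i _; exact: powR_ge0. Qed.

Lemma gpoly_gt0 r x u : (forall i, u != x i) -> 0 < gpoly r x u.
Proof.
by move=> ux; apply: prodr_gt0 => i _; rewrite powR_gt0// normr_gt0 subr_eq0.
Qed.

Lemma gpoly_root r x u i : 0 < r i -> u = x i -> gpoly r x u = 0.
Proof.
move=> ri ->; rewrite /gpoly (bigD1 i)//= subrr normr0 powR0 ?mul0r//.
by rewrite gt_eqF.
Qed.

Lemma ln_gpoly r x u : (forall i, u != x i) ->
  ln (gpoly r x u) = \sum_(i < n) r i * ln `|u - x i|.
Proof.
move=> ux; have ux0 i : 0 < `|u - x i| by rewrite normr_gt0 subr_eq0.
rewrite -[RHS]expRK expR_sum; congr (ln _); apply: eq_bigr => i _.
by rewrite /powR gt_eqF.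
Qed.

(** Each logarithmic increment r_i (ln |u - y_i| - ln |u - x_i|) is
r_i ln (1 + z) with z = (x_i - y_i) / (u - x_i), hence at most r_i z, strictly
when z != 0.  The first-order bound is global because ln T is concave in the
nodes as long as no node crosses u. *)
Lemma gpoly_lt_tangent r x y u :
    (forall i, 0 < r i) -> (forall i, 0 < (u - x i) * (u - y i)) ->
    \sum_(i < n) r i * (x i - y i) / (u - x i) <= 0 -> y <> x ->
  gpoly r y u < gpoly r x u.
Proof.
move=> r0 xy0 s0 yx.
have ux i : u != x i.
  by apply/eqP => h; have := xy0 i; rewrite h subrr mul0r ltxx.
have uy i : u != y i.
  by apply/eqP => h; have := xy0 i; rewrite h subrr mulr0 ltxx.
have [j yxj] : exists j, y j != x j.
  apply/not_existsP => h; apply: yx; apply/funext => i.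
  by apply/eqP/negPn/negP/h.
rewrite -ltr_ln ?posrE ?gpoly_gt0// !ln_gpoly//.
rewrite -subr_lt0 -sumrB; apply: lt_le_trans s0.
pose z i := (x i - y i) / (u - x i).
have z1 i : 1 + z i = (u - y i) / (u - x i).
  by rewrite /z; have := ux i; rewrite -subr_eq0 => h; field.
have z10 i : 0 < 1 + z i.
  have -> : 1 + z i = ((u - x i) * (u - y i)) / (u - x i) ^+ 2.
    by rewrite z1; have := ux i; rewrite -subr_eq0 => h; field.
  by rewrite divr_gt0// exprn_even_gt0//= subr_eq0.
have lnz i : r i * ln `|u - y i| - r i * ln `|u - x i| = r i * ln (1 + z i).
  rewrite -mulrBr -ln_div ?posrE ?normr_gt0 ?subr_eq0//.
  by rewrite -normrV ?unitfE ?subr_eq0// -normrM -z1 gtr0_norm.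
under eq_bigr do rewrite lnz.
under [ltRHS]eq_bigr do rewrite -mulrA -/(z _).
rewrite (bigD1 j)//= [ltRHS](bigD1 j)//=; apply: ltr_leD.
  rewrite ltr_pM2l// -ltr_expR lnK ?posrE// expR_gt1Dx//.
  by rewrite /z mulf_neq0 ?invr_eq0 ?subr_eq0// eq_sym.
by apply: ler_sum => i _; rewrite ler_pM2l// le_ln1Dx// -subr_gt0 opprK addrC.
Qed.

End Gpoly.

(** * Interlacing and Lagrange weights *)

Section Lagrange.
Variables (R : realType) (n : nat).

(** The sum is the coefficient of X^n in the Lagrange interpolant of p at the
n + 1 points t_k, and this interpolant is p itself, of degree less than n. *)
Lemma sum_lagrange_eq0 (t : 'I_n.+1 -> R) (p : {poly R}) :
    injective t -> (size p <= n)%N ->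
  \sum_(k < n.+1) p.[t k] / \prod_(i < n) (t k - t (lift k i)) = 0.
Proof.
move=> tI sp.
pose m (k : 'I_n.+1) := \prod_(i < n) ('X - (t (lift k i))%:P).
have mt k : (m k).[t k] = \prod_(i < n) (t k - t (lift k i)).
  by rewrite /m horner_prod; apply: eq_bigr => i _; rewrite !hornerE.
have mt0 k : (m k).[t k] != 0.
  rewrite mt; apply/prodf_neq0 => i _; rewrite subr_eq0 (inj_eq tI).
  exact: neq_lift.
have mtN k l : k != l -> (m k).[t l] = 0.
  move=> kl; have [i ->] := unlift_some kl.
  by rewrite /m horner_prod (bigD1 i)//= !hornerE subrr mul0r.
have sm k : size (m k) = n.+1.
  by rewrite /m size_prod_XsubC /index_enum -enumT size_enum_ord.
pose q := \sum_k (p.[t k] / (m k).[t k]) *: m k - p.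
have q0 : q = 0.
  apply/eqP; apply: contraT => qn0.
  have : all (root q) [seq t k | k <- enum 'I_n.+1].
    apply/allP => _ /mapP [l _ ->]; rewrite rootE /q hornerD hornerN horner_sum.
    rewrite (bigD1 l)//= big1 => [|k kl].
      2: by rewrite hornerZ (mtN _ _ kl) mulr0.
    by rewrite hornerZ divfK ?addr0 ?subrr.
  move=> /(max_poly_roots qn0); rewrite map_inj_uniq ?enum_uniq//.
  move=> /(_ isT); rewrite size_map size_enum_ord ltnNge => /negP[].
  rewrite (leq_trans (size_polyD _ _))// geq_max size_polyN (leqW sp) andbT.
  apply: (leq_trans (size_sum _ _ _)); apply/bigmax_leqP => k _.
  by rewrite (leq_trans (size_scale_leq _ _))// sm.
have := congr1 (fun f : {poly R} => f`_n) q0.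
rewrite /q coefB coef0 (nth_default _ sp) subr0 coef_sum => q0n.
rewrite -[RHS]q0n.
apply: eq_bigr => k _; rewrite coefZ -mt.
have : m k \is monic by exact: monic_prod_XsubC.
by rewrite monicE lead_coefE sm /= => /eqP ->; rewrite mulr1.
Qed.

(** Interlacing as a relation between all nodes and all points, so that order
comparisons need no passage through neighbours. *)
Definition separates (x : 'I_n -> R) (t : 'I_n.+1 -> R) : Prop :=
  forall (k : 'I_n.+1) (i : 'I_n),
    ((k <= i)%N -> t k < x i) /\ ((i < k)%N -> x i < t k).

Lemma separates_lt x t (k l : 'I_n.+1) :
  separates x t -> (k < l)%N -> t k < t l.
Proof.
move=> xt kl; have kn : (k < n)%N by rewrite (leq_trans kl)// -ltnS.
by apply: (@lt_trans _ _ (x (Ordinal kn))); apply xt.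
Qed.

Lemma separates_inj x t : separates x t -> injective t.
Proof.
move=> xt k l tkl; apply/val_inj.
have [/(separates_lt xt)|/(separates_lt xt)|//] := ltngtP k l.
all: by rewrite tkl ltxx.
Qed.

Lemma interlacing_separates (a b : R) x t : node_systems a b x ->
  interlacing a b x t <->
  separates x t /\ (forall k, a <= t k <= b).
Proof.
move=> [xab xle]; split=> [[at0 tnb xt]|[xt tab]]; last first.
  split; [by case/andP: (tab ord0)|by case/andP: (tab ord_max)|move=> i].
  by apply/andP; split; apply xt.
have sxt : separates x t.
  move=> k i; split=> ki.
    have kn : (k < n)%N by exact: leq_ltn_trans ki (ltn_ord i).
    apply: lt_le_trans (xle (Ordinal kn) i ki).
    by have /andP[+ _] := xt (Ordinal kn); congr (t _ < _); exact/val_inj.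
  have k0 : (0 < k)%N by exact: leq_trans ki.
  have kn : (k.-1 < n)%N by rewrite -ltnS prednK.
  apply: le_lt_trans (xle i (Ordinal kn) _) _.
    by rewrite /= -ltnS prednK.
  have /andP[_] := xt (Ordinal kn); congr (_ < t _).
  by apply/val_inj; rewrite /= /bump add1n prednK.
split=> // k; apply/andP; split.
  have [->//|k0] := eqVneq k ord0.
  by rewrite (le_trans at0)// ltW// (separates_lt sxt)// lt0n.
have [->//|k0] := eqVneq k ord_max.
rewrite (le_trans _ tnb)// ltW// (separates_lt sxt)//= ltn_neqAle.
by rewrite -ltnS ltn_ord andbT.
Qed.

(** The rational function prod_i (u - x_i) / prod_k (u - t_k) has the partial
fraction expansion sum_k c_k / (u - t_k), and it vanishes at every x_i.  Pairing
x_i with t_(lift k i) writes c_k as a product of n quotients, each positive by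
interlacing. *)
Lemma separates_weights x t : separates x t ->
  exists2 c : 'I_n.+1 -> R, (forall k, 0 < c k) &
    forall i, \sum_(k < n.+1) c k / (t k - x i) = 0.
Proof.
move=> xt; have tI := separates_inj xt.
exists (fun k => \prod_(i < n) ((t k - x i) / (t k - t (lift k i)))).
  move=> k; apply: prodr_gt0 => i _; have [ki|ik] := leqP k i.
    rewrite nmulr_rgt0 ?invr_lt0 ?subr_lt0; last by apply xt.
    by apply: (separates_lt xt); rewrite /= /bump ki add1n ltnS.
  rewrite divr_gt0// subr_gt0; first by apply xt.
  by apply: (separates_lt xt); rewrite /= /bump (leqNgt k i) ik.
move=> i.
(* c_k / (t_k - x_i) is p(t_k) over the Lagrange denominator at t_k. *)
pose p : {poly R} := \prod_(j < n | j != i) ('X - (x j)%:P).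
rewrite -[RHS](@sum_lagrange_eq0 t p tI); last first.
  apply: (leq_trans (size_poly_prod_leq _ _)).
  under eq_bigr do rewrite size_XsubC.
  rewrite sum_nat_const cardC1 card_ord muln2 -addnn -addSn addnK.
  by rewrite prednK// (leq_ltn_trans (leq0n i)).
apply: eq_bigr => k _; rewrite prodf_div mulrAC.
congr (_ / _).
rewrite (bigD1 i)//= /p horner_prod mulrC mulKf.
  by apply: eq_bigr => j _; rewrite !hornerE.
rewrite subr_eq0; have [ki|ik] := leqP k i.
  by rewrite lt_eqF//; apply xt.
by rewrite gt_eqF//; apply xt.
Qed.

(** The weights attached to x annihilate the first-order variations from x to y
on average, so one variation is nonpositive and the tangent inequality applies
at that point. *)
Lemma gpoly_lt_separates (r x y : 'I_n -> R) t :
    (forall i, 0 < r i) -> separates x t -> separates y t -> y <> x ->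
  exists k, gpoly r y (t k) < gpoly r x (t k).
Proof.
move=> r0 xt yt yx; have [c c0 cx] := separates_weights xt.
pose d k := \sum_(i < n) r i * (x i - y i) / (t k - x i).
have [k dk] : exists k, d k <= 0.
  apply/not_existsP => dgt0.
  suff : 0 < \sum_(k < n.+1) c k * d k.
    rewrite (_ : \sum_(k < _) _ = 0) ?ltxx//.
    under eq_bigr do rewrite mulr_sumr.
    rewrite exchange_big big1//= => i _.
    under eq_bigr do rewrite mulrCA.
    by rewrite -mulr_sumr cx mulr0.
  rewrite big_ord_recl ltr_pwDl//.
    by rewrite mulr_gt0// ltNge; exact/negP/dgt0.
  apply: sumr_ge0 => k _; apply: mulr_ge0; first exact: ltW.
  by rewrite leNgt; apply/negP => /ltW; exact: dgt0.
exists k; apply: gpoly_lt_tangent => // i; have [ki|ik] := leqP k i.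
  by rewrite nmulr_rgt0 subr_lt0; [apply yt|apply xt].
by rewrite mulr_gt0// subr_gt0; [apply xt|apply yt].
Qed.

End Lagrange.

(** * Semicontinuity and compactness *)

Section Topology.
Variable R : realType.

Lemma continuous_normr_powR (s : R) : 0 < s ->
  continuous (fun u : R => `|u| `^ s).
Proof.
move=> s0 u; have [->|u0] := eqVneq u 0.
  rewrite /continuous_at normr0 powR0 ?gt_eqF//.
  apply/cvgrPdist_lt => e e0; near=> v.
  rewrite sub0r normrN ger0_norm ?powR_ge0//.
  have -> : e = (e `^ s^-1) `^ s.
    by rewrite -powRrM mulVf ?gt_eqF// powRr1// ltW.
  rewrite gt0_ltr_powR ?nnegrE//; first exact: powR_ge0.
  near: v; apply: (@cvgr0_norm_lt _ _ _ (nbhs (0 : R)) _ id).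
    exact: cvg_id.
  exact: powR_gt0.
have nu0 : 0 < `|u| by rewrite normr_gt0.
apply: (@continuous_comp _ _ _ (fun v : R => `|v|) (fun v => v `^ s)).
  exact: norm_continuous.
apply: differentiable_continuous; apply/derivable1_diffP.
by apply: derivable_powR; rewrite in_itv/= nu0.
Unshelve. all: by end_near. Qed.

Lemma cvg_gpoly n (r x : 'I_n -> R) (u : R) (Z : Type) (G : set_system Z)
    (X : Z -> 'I_n -> R) (U : Z -> R) :
    Filter G -> (forall i, 0 < r i) -> U z @[z --> G] --> u ->
    (forall i, X z i @[z --> G] --> x i) ->
  gpoly r (X z) (U z) @[z --> G] --> gpoly r x u.
Proof.
move=> FG r0 Uu Xx; apply: cvg_big => [|i _]; first exact: mul_continuous.
apply: (@cvg_comp _ _ _ (fun z => U z - X z i) (fun v => `|v| `^ r i) G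
  (nbhs (u - x i))); first exact: cvgB.
exact: continuous_normr_powR.
Qed.

(** Covering [a, b] by neighbourhoods bounds f; if the supremum s were not
attained, covering again would give a uniform e > 0 with f <= s - e. *)
Lemma usc_max (a b : R) (f : R -> R) : a <= b -> usc_on `[a, b] f ->
  exists2 u, a <= u <= b & forall v, a <= v <= b -> f v <= f u.
Proof.
move=> ab uscf.
have /compact_near_coveringP/near_covering_withinP cov :=
  @segment_compact R a b.
have [M fM] : exists M, forall u, a <= u <= b -> f u < M.
  have : \forall M \near +oo, `[a, b] `<=` [set u | f u < M].
    apply: cov => u ab_u; have fu1 : f u < f u + 1 by rewrite ltrDl.
    have fM : \forall M \near +oo, f u + 1 < M.
      by apply: nbhs_pinfty_gt; exact: num_real.
    have ufu : \forall v \near u, `[a, b]%classic v -> f v < f u + 1.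
      exact: uscf u ab_u _ fu1.
    near=> v M => ab_v; apply: (@lt_trans _ _ (f u + 1)).
      by apply: (near ufu v).
    exact: (near fM M).
  by move=> /filter_ex[M fM]; exists M => u uab; apply: fM; rewrite /= in_itv.
pose S := f @` `[a, b].
have aab : `[a, b]%classic a by rewrite /= in_itv/= lexx.
have supS : has_sup S.
  split; first by exists (f a), a.
  by exists M => _ [u uab <-]; apply: ltW; apply: fM; rewrite /= in_itv in uab.
have fS u : `[a, b]%classic u -> f u <= sup S.
  by move=> uab; apply: ub_le_sup; [exact: supS.2|exists u].
apply: contrapT => nomax.
have fltS u : `[a, b]%classic u -> f u < sup S.
  move=> uab; rewrite lt_neqAle fS// andbT; apply/eqP => fu; apply: nomax.
  exists u => [|v vab]; first by move: uab; rewrite /= in_itv.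
  by rewrite fu fS//= in_itv.
have : \forall e \near 0^'+, `[a, b] `<=` [set u | f u <= sup S - e].
  apply: cov => u uab; pose d := (sup S - f u) / 2.
  have d0 : 0 < d by rewrite divr_gt0// subr_gt0 fltS.
  have fud : f u < f u + d by rewrite ltrDl.
  have ed : \forall e \near (0 : R)^'+, e < d by exact: nbhs_right_lt.
  have ufu : \forall v \near u, `[a, b]%classic v -> f v < f u + d.
    exact: uscf u uab _ fud.
  near=> v e => vab; have : f v < f u + d by apply: (near ufu v).
  have : e < d by exact: (near ed e).
  by rewrite /= /d; lra.
move=> fe; have [e [e0 Se]] :
    exists e, 0 < e /\ `[a, b] `<=` [set u | f u <= sup S - e].
  apply: (@filter_ex _ (0^'+ : set_system R)).
  by near=> e; split; near: e => //; exact: nbhs_right_gt.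
have : sup S <= sup S - e.
  by apply: ge_sup => [|_ [u uab <-]]; [exact: supS.1|exact: Se].
by rewrite leNgt ltrBlDr ltrDl e0.
Unshelve. all: by end_near. Qed.

(** Upper semicontinuity of w(u) T_x(u) jointly in u and x: a product of
nonnegative functions, one upper semicontinuous and the other continuous.  The
parameter z lets u and the nodes vary along independent filters. *)
Lemma near_usc_gpoly_lt n (r : 'I_n -> R) (a b : R) (w : R -> R) (x : 'I_n -> R)
    (u M : R) (Z : Type) (G : set_system Z)
    (X : Z -> 'I_n -> R) (U : Z -> R) :
    Filter G -> (forall i, 0 < r i) -> usc_on `[a, b] w ->
    (forall v, a <= v <= b -> 0 <= w v) -> a <= u <= b ->
    U z @[z --> G] --> u -> (forall i, X z i @[z --> G] --> x i) ->
    w u * gpoly r x u < M ->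
  \forall z \near G, a <= U z <= b -> w (U z) * gpoly r (X z) (U z) < M.
Proof.
move=> FG r0 uscw w0 uab Uu Xx uM.
have [e [e0 eM]] : exists e, 0 < e /\ (w u + e) * (gpoly r x u + e) < M.
  apply: (@filter_ex _ (0^'+ : set_system R)); near=> e; split; near: e.
    exact: nbhs_right_gt.
  have pc (c : R) : c + e @[e --> 0^'+] --> c.
    rewrite -[X in _ --> X]addr0; apply: cvgD; first exact: cvg_cst.
    exact: cvg_at_right_filter cvg_id.
  have : (w u + e) * (gpoly r x u + e) @[e --> 0^'+] --> w u * gpoly r x u.
    by apply: cvgM; exact: pc.
  by move/cvgr_lt; exact.
have we : w u < w u + e by rewrite ltrDl.
have Uwe : \forall z \near G, a <= U z <= b -> w (U z) < w u + e.
  have uab' : `[a, b]%classic u by rewrite /= in_itv.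
  apply: (@filterS _ G FG _ _ _ (Uu _ (uscw u uab' _ we))) => z Uz zab.
  by apply: Uz; rewrite /= in_itv.
have gpe : \forall z \near G, gpoly r (X z) (U z) < gpoly r x u + e.
  by apply: (cvgr_lt _ (cvg_gpoly FG r0 Uu Xx)); rewrite ltrDl.
near=> z => zab; apply: le_lt_trans eM; apply: ler_pM.
- exact: w0.
- exact: gpoly_ge0.
- by apply/ltW; exact: (near Uwe z).
- by apply/ltW; near: z.
Unshelve. all: by end_near. Qed.

End Topology.

Section Minimizer.
Variables (R : realType) (n : nat) (r : 'I_n -> R) (a b : R) (w : R -> R).
Hypotheses (r0 : forall i, 0 < r i) (ab : a < b) (uscw : usc_on `[a, b] w).
Hypothesis (w0 : forall u, a <= u <= b -> 0 <= w u).

(** The norm as a real number; [wmaxP] shows that it is finite and attained. *)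
Definition wmax (x : 'I_n -> R) : R := fine (wnorm r a b w x).

Lemma usc_wgpoly x : usc_on `[a, b] (fun u => w u * gpoly r x u).
Proof.
move=> u uab c uc; rewrite /= in_itv/= in uab.
have near_c : \forall v \near u, a <= v <= b -> w v * gpoly r x v < c.
  apply: (near_usc_gpoly_lt _ r0 uscw w0 uab cvg_id _ uc) => i.
  exact: cvg_cst.
rewrite near_withinE; near=> v => vab; rewrite /= in_itv in vab.
by apply: (near near_c v).
Unshelve. all: by end_near. Qed.

Lemma wmaxP x : [/\ wnorm r a b w x = (wmax x)%:E,
  forall u, a <= u <= b -> w u * gpoly r x u <= wmax x &
  exists2 u, a <= u <= b & w u * gpoly r x u = wmax x].
Proof.
have [u uab umax] := usc_max (ltW ab) (@usc_wgpoly x).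
have wE : wnorm r a b w x = (w u * gpoly r x u)%:E.
  apply/eqP; rewrite eq_le; apply/andP; split.
    apply: ge_ereal_sup => y [v]; rewrite /= in_itv/= => vab <-.
    by rewrite lee_fin ger0_norm ?umax// mulr_ge0 ?w0 ?gpoly_ge0.
  apply: ereal_sup_ubound; exists u; first by rewrite /= in_itv.
  by rewrite ger0_norm// mulr_ge0 ?w0 ?gpoly_ge0.
by rewrite /wmax wE; split=> //; exists u.
Qed.

Lemma wmax_ge0 x : 0 <= wmax x.
Proof.
have [_ _ [u uab <-]] := wmaxP x.
by rewrite mulr_ge0 ?w0 ?gpoly_ge0.
Qed.

Lemma extremizerP x : extremizer r a b w x <->
  node_systems a b x /\ forall y, node_systems a b y -> wmax x <= wmax y.
Proof.
split=> -[xN xmin]; split=> //.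
  move=> y yN; have [xE _ _] := wmaxP x; have [yE _ _] := wmaxP y.
  rewrite -lee_fin -xE -yE xmin.
  by apply: ereal_inf_lbound; exists y.
apply/eqP; rewrite eq_le; apply/andP; split.
  apply: le_ereal_inf_tmp => _ [y yN <-].
  have [-> _ _] := wmaxP x; have [-> _ _] := wmaxP y.
  by rewrite lee_fin xmin.
by apply: ereal_inf_lbound; exists x.
Qed.

(** For fixed u the value w(u) T_x(u) is continuous in x, so a value of the norm
above the infimum m stays above m + e near x.  If no x attained m, compactness
of the box [a, b]^n would make e uniform.  The order constraint is closed, so
there is no node system at all near a point of the box that violates it. *)
Lemma extremizer_exists : exists x, extremizer r a b w x.
Proof.
apply: contrapT => noext.
pose NS := [set y : 'I_n -> R | node_systems a b y].
pose m := inf (wmax @` NS).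
have NSa : NS (fun=> a) by split=> *; rewrite lexx// ltW.
have lbm : has_lbound (wmax @` NS).
  by exists 0 => _ [y _ <-]; exact: wmax_ge0.
have mlt x : node_systems a b x -> m < wmax x.
  move=> xN; rewrite lt_neqAle; apply/andP; split; last first.
    by apply: ge_inf => //; exists x.
  apply/eqP => mx; apply: noext; exists x; apply/extremizerP; split=> // y yN.
  by rewrite -mx; apply: ge_inf => //; exists y.
have /compact_near_coveringP/near_covering_withinP cov :
    compact [set v : 'rV[R]_n | forall i, `[a, b]%classic (v ord0 i)].
  apply: (@rV_compact R^o n (fun=> `[a, b]%classic)) => i.
  exact: segment_compact.
have : \forall e \near 0^'+,
    [set v : 'rV[R]_n | forall i, `[a, b]%classic (v ord0 i)] `<=`
    [set v | node_systems a b (v ord0) -> m + e <= wmax (v ord0)].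
  apply: cov => v vab.
  have cv i : (fun v' : 'rV[R]_n => v' ord0 i) @ v --> v ord0 i.
    exact: coord_continuous.
  have [vN|vN] := pselect (node_systems a b (v ord0)).
    have [_ _ [u uab uE]] := wmaxP (v ord0).
    have mu : m < w u * gpoly r (v ord0) u by rewrite uE mlt.
    pose d := (w u * gpoly r (v ord0) u - m) / 2.
    have d0 : 0 < d by rewrite divr_gt0// subr_gt0.
    have ed : \forall e \near (0 : R)^'+, e < d by exact: nbhs_right_lt.
    have vd : \forall v' \near v,
        m + d < w u * gpoly r ((v' : 'rV[R]_n) ord0) u.
      have cvg : (fun v' : 'rV[R]_n => w u * gpoly r (v' ord0) u) @ v -->
          w u * gpoly r (v ord0) u.
        apply: (@cvgM _ _ (nbhs v) _ (fun=> w u)); first exact: cvg_cst.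
        apply: (@cvg_gpoly _ _ _ _ _ _ _ (fun v' : 'rV[R]_n => v' ord0)) => //.
        exact: cvg_cst.
      by apply: (cvgr_gt _ cvg); rewrite /d; lra.
    near=> v' e => v'ab v'N; have [_ /(_ _ uab) v'u _] := wmaxP (v' ord0).
    have v'd : m + d < w u * gpoly r (v' ord0) u by near: v'.
    have : e < d by exact: (near ed e).
    by rewrite /=; lra.
  have [i [j [ij vij]]] : exists i j : 'I_n, (i <= j)%N /\ v ord0 j < v ord0 i.
    apply: contrapT => nij; apply: vN; split=> [i|i j ij].
      by have := vab i; rewrite /= in_itv.
    by rewrite leNgt; apply/negP => ji; apply: nij; exists i, j.
  have vd : \forall v' \near v, 0 < (v' : 'rV[R]_n) ord0 i - v' ord0 j.
    by apply: (cvgr_gt _ (cvgB (cv i) (cv j))); rewrite subr_gt0.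
  near=> v' e => _ [_ /(_ i j ij)]; rewrite leNgt => /negP[].
  by rewrite -subr_gt0; exact: (near vd v').
move=> me; have [e [e0 Ne]] :
    exists e, 0 < e /\ forall x, node_systems a b x -> m + e <= wmax x.
  apply: (@filter_ex _ (0^'+ : set_system R)).
  near=> e; split; first by near: e; exact: nbhs_right_gt.
  move=> x xN.
  have -> : x = (\row_i x i) ord0 by apply/funext => i; rewrite mxE.
  apply: (near me e) => //=.
    by move=> i; rewrite mxE in_itv/=; case: xN => + _; apply.
  by have <- : x = (\row_i x i) ord0 by apply/funext => i; rewrite mxE.
have : m + e <= m.
  apply: lb_le_inf; first by exists (wmax (fun=> a)), (fun=> a).
  by move=> _ [x xN <-]; exact: Ne.
by rewrite leNgt ltrDl e0.
Unshelve. all: by end_near. Qed.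

End Minimizer.

(** * Opening a gap between two clusters of nodes *)

Section Spreading.
Variables (R : realType) (n : nat) (r : 'I_n -> R).
Hypothesis r0 : forall i, 0 < r i.
Implicit Types (x d : 'I_n -> R) (k : 'I_n.+1).

(** On each side of u the function 1 / (u - s) increases with s, so a node that
moves away from c contributes at least what the same velocity would contribute
at c.  This reduces the sign of the whole sum to that of its weight at c. *)
Lemma sumr_pivot_ge0 x d (u c : R) :
    (forall i, d i != 0 -> 0 <= d i * (x i - c) /\ 0 < (u - x i) * (u - c)) ->
    0 <= (\sum_(i < n) r i * d i) / (u - c) ->
  0 <= \sum_(i < n) r i * d i / (u - x i).
Proof.
move=> dc /le_trans; apply; rewrite mulr_suml; apply: ler_sum => i _.
have [->|/dc[dxc uxc]] := eqVneq (d i) 0; first by rewrite mulr0 !mul0r.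
have [ux uc] : u - x i != 0 /\ u - c != 0.
  by apply/andP; rewrite -negb_or -mulf_eq0 gt_eqF.
rewrite -!mulrA ler_pM2l// -subr_ge0.
have -> : d i / (u - x i) - d i / (u - c) =
    d i * (x i - c) / ((u - x i) * (u - c)) by field; rewrite ux uc.
by rewrite divr_ge0// ltW.
Qed.

(** Gap k lies after the nodes of index less than k.  Several nodes may coincide
at one of its ends; they have to move together to remain ordered. *)
Definition left_end x k : pred 'I_n := fun i =>
  (i < k)%N && [forall j : 'I_n, (j < k)%N ==> (x j <= x i)].

Definition right_end x k : pred 'I_n := fun i =>
  (k <= i)%N && [forall j : 'I_n, (k <= j)%N ==> (x i <= x j)].

(** Velocities that open gap k.  Dividing by the total exponent of a cluster at
position c makes its contribution to the derivative of -ln T(u) equal to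
-1 / (u - c) for the left cluster and 1 / (u - c) for the right one. *)
Definition spread x k : 'I_n -> R := fun i =>
  if left_end x k i then - (\sum_(j | left_end x k j) r j)^-1
  else if right_end x k i then (\sum_(j | right_end x k j) r j)^-1 else 0.

Lemma sum_pos_gt0 (P : pred 'I_n) i : P i -> 0 < \sum_(j | P j) r j.
Proof.
move=> Pi; rewrite (bigD1 i)//= ltr_pwDl//.
by apply: sumr_ge0 => j _; exact: ltW.
Qed.

Lemma spread_left x k i : left_end x k i -> spread x k i < 0.
Proof. by move=> Ai; rewrite /spread Ai oppr_lt0 invr_gt0 (sum_pos_gt0 Ai). Qed.

Lemma right_endN x k i : right_end x k i -> left_end x k i = false.
Proof. by case/andP => ki _; rewrite /left_end ltnNge ki. Qed.

Lemma spread_right x k i : right_end x k i -> 0 < spread x k i.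
Proof.
by move=> Bi; rewrite /spread right_endN// Bi invr_gt0 (sum_pos_gt0 Bi).
Qed.

Lemma spreadP x k i : spread x k i != 0 -> left_end x k i \/ right_end x k i.
Proof.
rewrite /spread; case: ifPn => [|_]; first by left.
by case: ifPn => [|_]; [right|rewrite eqxx].
Qed.

(** The quotients are 1 or 0 according as the cluster is nonempty or empty; a
cluster is empty when the gap is bounded by an endpoint of the interval. *)
Lemma sum_spread x k (A := \sum_(j | left_end x k j) r j)
    (B := \sum_(j | right_end x k j) r j) :
  \sum_(i < n) r i * spread x k i = B / B - A / A.
Proof.
rewrite {1}/B {1}/A !mulr_suml -sumrN [in RHS]big_mkcond.
rewrite [X in _ + X]big_mkcond -big_split/=; apply: eq_bigr => i _.
rewrite /spread; case: ifPn => [Ai|Ai].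
  by case: ifPn => [/right_endN|_]; rewrite ?Ai// add0r mulrN.
by case: ifPn => _; rewrite addr0// mulr0.
Qed.

Lemma divrr_itv (s : R) : 0 <= s / s <= 1.
Proof.
by have [->|s0] := eqVneq s 0; rewrite ?mul0r ?divff// ?lexx ler01.
Qed.

(** This keeps coincident nodes ordered while they move; distinct nodes stay
ordered for a short time by continuity. *)
Lemma spread_mono x k (i j : 'I_n) :
    (forall i j : 'I_n, (i <= j)%N -> x i <= x j) ->
  (i <= j)%N -> x i = x j -> spread x k i <= spread x k j.
Proof.
move=> xle ij xij; rewrite {2}/spread; case: ifPn => [/andP[jk /forallP jx]|_].
  suff Ai : left_end x k i by rewrite /spread Ai.
  rewrite /left_end (leq_ltn_trans ij jk) /=; apply/forallP => l.
  by rewrite xij; exact: jx.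
have [Bi|Bi] := boolP (right_end x k i).
  have Bj : right_end x k j.
    case/andP: Bi => ki /forallP ix; rewrite /right_end (leq_trans ki ij)/=.
    by apply/forallP => l; rewrite -xij; exact: ix.
  by rewrite Bj /spread right_endN// Bi.
apply: (@le_trans _ _ 0).
  have [Ai|Ai] := boolP (left_end x k i); first exact/ltW/spread_left.
  by rewrite /spread (negbTE Ai) (negbTE Bi).
case: ifPn => // Bj; rewrite invr_ge0; apply/ltW; exact: sum_pos_gt0 Bj.
Qed.

Lemma spread_right_ge0 x k i u : right_end x k i -> x i < u ->
    (forall i j : 'I_n, (i <= j)%N -> x i <= x j) ->
  0 <= \sum_(j < n) r j * spread x k j / (u - x j).
Proof.
move=> Bi iu xle; have /andP[ki /forallP ix] := Bi.
apply: (@sumr_pivot_ge0 x (spread x k) u (x i)).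
  move=> j /spreadP[Aj|Bj].
    have xji : x j <= x i.
      by apply: xle; case/andP: Aj => jk _; exact: ltnW (leq_trans jk ki).
    split; last by rewrite mulr_gt0// subr_gt0// (le_lt_trans xji).
    by rewrite mulr_le0 ?subr_le0//; exact/ltW/spread_left.
  have -> : x j = x i.
    case/andP: Bj => kj /forallP jx; apply/eqP; rewrite eq_le.
    by rewrite (implyP (jx i))// (implyP (ix j)).
  by rewrite subrr mulr0; split=> //; rewrite mulr_gt0// subr_gt0.
rewrite sum_spread divff ?gt_eqF ?(sum_pos_gt0 Bi)//.
rewrite divr_ge0// subr_ge0 ?(ltW iu)//.
by case/andP: (divrr_itv (\sum_(j | left_end x k j) r j)).
Qed.

Lemma spread_left_ge0 x k i u : left_end x k i -> u < x i ->
    (forall i j : 'I_n, (i <= j)%N -> x i <= x j) ->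
  0 <= \sum_(j < n) r j * spread x k j / (u - x j).
Proof.
move=> Ai ui xle; have /andP[ik /forallP ix] := Ai.
apply: (@sumr_pivot_ge0 x (spread x k) u (x i)).
  move=> j /spreadP[Aj|Bj].
    have -> : x j = x i.
      case/andP: Aj => jk /forallP jx; apply/eqP; rewrite eq_le.
      by rewrite (implyP (jx i))// (implyP (ix j)).
    by rewrite subrr mulr0; split=> //; rewrite nmulr_rgt0 subr_lt0.
  have xij : x i <= x j.
    by apply: xle; case/andP: Bj => kj _; exact: ltnW (leq_trans ik kj).
  split; last by rewrite nmulr_rgt0 subr_lt0// (lt_le_trans ui).
  by rewrite mulr_ge0 ?subr_ge0//; exact/ltW/spread_right.
rewrite sum_spread [X in _ - X]divff ?gt_eqF ?(sum_pos_gt0 Ai)//.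
apply: mulr_le0; rewrite ?invr_le0 subr_le0 ?(ltW ui)//.
by case/andP: (divrr_itv (\sum_(j | right_end x k j) r j)).
Qed.

End Spreading.

(** * Minimizers equioscillate *)

Section Equioscillation.
Variables (R : realType) (n : nat) (r : 'I_n -> R) (a b : R) (w : R -> R).
Hypotheses (r0 : forall i, 0 < r i) (ab : a < b) (uscw : usc_on `[a, b] w).
Hypothesis (w0 : forall u, a <= u <= b -> 0 <= w u).
Hypothesis wnz : exists2 z : 'I_n.+1 -> R, injective z &
  forall k, a <= z k <= b /\ w (z k) != 0.

Local Notation wmax := (wmax r a b w).

(** T_x has at most n zeros, so it does not vanish at all n + 1 points z_k. *)
Lemma wmax_gt0 x : 0 < wmax x.
Proof.
have [z zI zP] := wnz.
have [k zk] : exists k, forall i, z k != x i.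
  apply: contrapT => noz.
  have /choice [f fP] k : exists i, z k = x i.
    apply: contrapT => zk; apply: noz; exists k => i.
    by apply/eqP => zx; apply: zk; exists i.
  have fI : injective f by move=> k l fkl; apply: zI; rewrite !fP fkl.
  by have := leq_card f fI; rewrite !card_ord ltnn.
have [_ /(_ _ (zP k).1) wle _] := wmaxP r0 ab uscw w0 x.
apply: lt_le_trans wle; rewrite mulr_gt0 ?gpoly_gt0// lt_neqAle eq_sym.
by rewrite (zP k).2 w0// (zP k).1.
Qed.

(** Projecting the nodes to [a, b] brings them closer to every point of [a, b];
hence the perturbation of a node system may leave the interval. *)
Definition clamp (v : R) := Num.max a (Num.min b v).

Lemma gpoly_clamp x u : a <= u <= b -> gpoly r (clamp \o x) u <= gpoly r x u.
Proof.
move=> /andP[au ub]; apply: ler_prod => i _; rewrite powR_ge0/=.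
apply: ge0_ler_powR; rewrite ?nnegrE//; first exact: ltW.
rewrite /= /clamp ler_norml; case: (lerP b (x i)) => bx.
  rewrite (max_r (ltW ab)) ler0_norm; lra.
by case: (lerP a (x i)) => ax; case: (ger0P (u - x i)) => ux; lra.
Qed.

Lemma clamp_nodes x : (forall i j : 'I_n, (i <= j)%N -> x i <= x j) ->
  node_systems a b (clamp \o x).
Proof.
move=> xle; split=> [i|i j /xle xij] /=.
  by rewrite /clamp le_max lexx /= ge_max (ltW ab) ge_min lexx.
by rewrite /clamp ge_max !le_max lexx /= le_min !ge_min lexx xij !orbT.
Qed.

(** If the maximum were not reached in gap k, opening the gap would lower
w T below its maximum M near every point: by tangency where w T_x = M, since
such points lie strictly on one side of the gap, and by semicontinuity
elsewhere. *)
Lemma extremizer_gap x (k : 'I_n.+1) : extremizer r a b w x ->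
  exists u, [/\ a <= u <= b, w u * gpoly r x u = wmax x &
    forall i : 'I_n, ((k <= i)%N -> u < x i) /\ ((i < k)%N -> x i < u)].
Proof.
move=> /(extremizerP r0 ab uscw w0)[[xab xle] xmin]; apply: contrapT => nogap.
have [_ xmax _] := wmaxP r0 ab uscw w0 x.
have M0 := wmax_gt0 x.
have offx u i : w u * gpoly r x u = wmax x -> u != x i.
  move=> uE; apply/eqP => ux; move: M0.
  by rewrite -uE (gpoly_root _ ux)// mulr0 ltxx.
have side u : a <= u <= b -> w u * gpoly r x u = wmax x ->
    exists i, (left_end x k i /\ u < x i) \/ (right_end x k i /\ x i < u).
  move=> uab uE; apply: contrapT => noside; apply: nogap; exists u; split=> //.
  move=> i; split=> ki; rewrite ltNge; apply/negP => xu.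
    have kn : (k < n)%N := leq_ltn_trans ki (ltn_ord i).
    apply: noside; exists (Ordinal kn); right; split.
      rewrite /right_end leqnn/=; apply/forallP => j; apply/implyP => kj.
      exact: xle.
    by rewrite lt_neqAle eq_sym offx//= (le_trans _ xu)// xle.
  have k0 : (0 < k)%N by exact: leq_trans ki.
  have kn : (k.-1 < n)%N by rewrite -ltnS prednK.
  apply: noside; exists (Ordinal kn); left; split.
    rewrite /left_end /= prednK// leqnn/=; apply/forallP => j.
    apply/implyP => jk.
    by apply: xle; rewrite /= -ltnS prednK.
  rewrite lt_neqAle offx//= (le_trans xu)// xle//= -ltnS prednK//.
pose d := spread r x k.
pose X (e : R) : 'I_n -> R := fun i => x i + e * d i.
have Xcvg i : X e i @[e --> 0^'+] --> x i.
  apply: cvg_at_right_filter.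
  rewrite -[X in _ --> X]addr0 -[X in _ + X](mul0r (d i)).
  by apply: cvgD; [exact: cvg_cst|apply: cvgM; [exact: cvg_id|exact: cvg_cst]].
have /compact_near_coveringP/near_covering_withinP cov :=
  @segment_compact R a b.
have Xlt : \forall e \near 0^'+,
    `[a, b] `<=` [set u | w u * gpoly r (X e) u < wmax x].
  apply: cov => u; rewrite /= in_itv/= => uab.
  have near2u (P : R -> R -> Prop) :
      (\forall z \near (nbhs u, (0 : R)^'+), P z.1 z.2) ->
      \forall v \near u & e \near (0 : R)^'+, P v e by rewrite -near2_curry.
  have Xcvg2 i : X z.2 i @[z --> (nbhs u, (0 : R)^'+)] --> x i.
    by apply: (cvg_comp _ _ _ (Xcvg i)); exact: cvg_snd.
  have Ucvg : z.1 @[z --> (nbhs u, (0 : R)^'+)] --> u by exact: cvg_fst.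
  have := xmax u uab; rewrite le_eqVlt => /orP[/eqP uE|uM]; last first.
    have near_uM : \forall z \near (nbhs u, (0 : R)^'+),
        a <= z.1 <= b -> w z.1 * gpoly r (X z.2) z.1 < wmax x.
      exact: near_usc_gpoly_lt _ r0 uscw w0 uab Ucvg Xcvg2 uM.
    apply: near2u; near=> z; rewrite /= in_itv/= => zab.
    by apply: (near near_uM z).
  (* The cluster between u and the gap is the pivot of the variation at u. *)
  have [i0 i0side] := side u uab uE.
  have d0 : d i0 != 0.
    case: i0side => -[i0e _].
      by rewrite lt_eqF// spread_left.
    by rewrite gt_eqF// spread_right.
  have sum_near : \forall v \near u,
      0 <= \sum_(i < n) r i * d i / (v - x i).
    case: i0side => -[i0e ui0].
      near=> v; apply: (spread_left_ge0 r0 i0e) => //.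
      by near: v; exact: lt_nbhsl.
    near=> v; apply: (spread_right_ge0 r0 i0e) => //.
    by near: v; exact: lt_nbhsr.
  have same_side : \forall z \near (nbhs u, (0 : R)^'+),
      forall i, 0 < (z.1 - x i) * (z.1 - X z.2 i).
    have F2 : Filter (filter_prod (nbhs u) ((0 : R)^'+)).
      exact: filter_prod_filter.
    apply: (@filter_forall _ _ _ _ F2) => i.
    have cvgS : (z.1 - x i) * (z.1 - X z.2 i) @[z --> (nbhs u, (0 : R)^'+)] -->
        (u - x i) * (u - x i).
      by apply: cvgM; apply: cvgB => //; exact: cvg_cst.
    apply: (cvgr_gt _ cvgS); rewrite -expr2 exprn_even_gt0//= subr_eq0.
    exact: offx.
  have e_gt0 : \forall e \near (0 : R)^'+, 0 < e by exact: nbhs_right_gt.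
  have sum_near2 : \forall z \near (nbhs u, (0 : R)^'+),
      0 <= \sum_(i < n) r i * d i / (z.1 - x i) by exact: cvg_fst sum_near.
  have e_gt02 : \forall z \near (nbhs u, (0 : R)^'+), 0 < z.2.
    exact: cvg_snd e_gt0.
  apply: near2u; near=> z; rewrite /= in_itv/=.
  set v := z.1; set e := z.2 => vab.
  have vX : forall i, 0 < (v - x i) * (v - X e i) by apply: (near same_side z).
  have vsum : 0 <= \sum_(i < n) r i * d i / (v - x i).
    by apply: (near sum_near2 z).
  have e0 : 0 < e by apply: (near e_gt02 z).
  have vlt : gpoly r (X e) v < gpoly r x v.
    apply: gpoly_lt_tangent => //.
      under eq_bigr do rewrite opprD addNKr mulrN mulrCA mulNr -mulrA.
      by rewrite sumrN -mulr_sumr oppr_le0 mulr_ge0// ltW.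
    move=> Xx; move/eqP: d0; apply; have := congr1 (fun f => f i0) Xx.
    by move=> /eqP; rewrite -subr_eq0 addrC addKr mulf_eq0 gt_eqF//= => /eqP.
  have [wv0|wv0] := eqVneq (w v) 0; first by rewrite wv0 mul0r.
  apply: (lt_le_trans _ (xmax v vab)).
  by rewrite ltr_pM2l// lt_neqAle eq_sym wv0 w0.
have Xle : \forall e \near 0^'+,
    forall i j : 'I_n, (i <= j)%N -> X e i <= X e j.
  apply: filter_forall => i; apply: filter_forall => j.
  have [ij|] := boolP (i <= j)%N; last by move=> _; exact: nearW.
  have := xle i j ij; rewrite le_eqVlt => /orP[/eqP xij|xij].
    near=> e => _; rewrite /X xij lerD2l ler_wpM2l//.
    exact: spread_mono.
  near=> e => _; rewrite -subr_ge0 ltW//; near: e.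
  by apply: (cvgr_gt _ (cvgB (Xcvg j) (Xcvg i))); rewrite subr_gt0.
have [e [elt ele]] : exists e,
    (forall u, a <= u <= b -> w u * gpoly r (X e) u < wmax x) /\
    (forall i j : 'I_n, (i <= j)%N -> X e i <= X e j).
  apply: (@filter_ex _ (0^'+ : set_system R)); near=> e; split; last by near: e.
  by move=> u uab; apply: (near Xlt e); rewrite //= in_itv.
have := xmin _ (clamp_nodes ele).
have [_ _ [u uab <-]] := wmaxP r0 ab uscw w0 (clamp \o X e).
rewrite leNgt => /negP[]; apply: le_lt_trans (elt u uab).
by rewrite ler_wpM2l ?w0// gpoly_clamp.
Unshelve. all: by end_near. Qed.

End Equioscillation.

(** * Equioscillation determines the nodes *)

Lemma ord_ltn_homo_id n (f : 'I_n -> 'I_n) :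
  (forall i j : 'I_n, (i < j)%N -> (f i < f j)%N) -> f =1 id.
Proof.
have leqf (g : 'I_n -> 'I_n) :
    (forall i j : 'I_n, (i < j)%N -> (g i < g j)%N) ->
    forall k : 'I_n, (k <= g k)%N.
  move=> gh [k kn]; elim: k kn => //= k IH kn.
  have k'n : (k < n)%N by exact: ltnW.
  by apply: leq_ltn_trans (IH k'n) (gh (Ordinal k'n) (Ordinal kn) _).
move=> fh k; apply/val_inj/eqP; rewrite /= eqn_leq leqf// andbT.
have : (rev_ord k <= rev_ord (f (rev_ord (rev_ord k))))%N.
  apply: (leqf (fun i => rev_ord (f (rev_ord i)))) => i j ij /=.
  have := fh (rev_ord j) (rev_ord i).
  have := ltn_ord i; have := ltn_ord j.
  have := ltn_ord (f (rev_ord i)); have := ltn_ord (f (rev_ord j)).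
  by move=> /=; lia.
rewrite rev_ordK /=; have := ltn_ord k; have := ltn_ord (f k); lia.
Qed.

Section Uniqueness.
Variables (R : realType) (n : nat) (r : 'I_n -> R) (a b : R).
Hypotheses (r0 : forall i, 0 < r i) (ab : a < b).

Lemma extremizer_separates (w : R -> R) x :
    usc_on `[a, b] w -> (forall u, a <= u <= b -> 0 <= w u) ->
    (exists2 z : 'I_n.+1 -> R, injective z &
      forall k, a <= z k <= b /\ w (z k) != 0) ->
    extremizer r a b w x ->
  exists2 t, separates x t &
    forall k, a <= t k <= b /\ w (t k) * gpoly r x (t k) = wmax r a b w x.
Proof.
move=> uscw w0 wnz xext.
have /choice[t tP] k := extremizer_gap r0 ab uscw w0 wnz k xext.
by exists t => [k i|k]; have [] := tP k.
Qed.

(** For the discrete weight 1 / T_y on the points t_k, the norm of y is 1 and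
that of x is at most 1.  A minimizer z equioscillates at n + 1 points of the
support {t_k}, hence at all of them, so z is interlaced with t and
[gpoly_lt_separates] gives z = y.  So y is the only minimizer, and x is one. *)
Lemma gpoly_le_eq x y t :
    node_systems a b x -> node_systems a b y ->
    separates y t -> (forall k, a <= t k <= b) ->
    (forall k, gpoly r x (t k) <= gpoly r y (t k)) ->
  x = y.
Proof.
move=> xN yN yt tab xley.
pose w u := if [exists k, u == t k] then (gpoly r y u)^-1 else 0.
have yt0 k : 0 < gpoly r y (t k).
  apply: gpoly_gt0 => i; have [ki|ik] := leqP k i.
    by rewrite lt_eqF//; apply yt.
  by rewrite gt_eqF//; apply yt.
have wt k : w (t k) = (gpoly r y (t k))^-1.
  by rewrite /w; case: existsP => // -[]; exists k.
have w0 u : 0 <= w u.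
  by rewrite /w; case: ifP => // _; rewrite invr_ge0 gpoly_ge0.
have uscw : usc_on `[a, b] w.
  move=> u _ c uc; apply: cvg_within.
  have c0 : 0 < c by exact: le_lt_trans (w0 u) uc.
  (* The support of w is finite: u is its only possible point near u. *)
  have : \forall v \near u, forall k, v != u -> v != t k.
    apply: (@filter_forall _ _ _ (nbhs u)) => k.
    have [->|utk] := eqVneq u (t k); first exact: nearW.
    near=> v => _; near: v; apply: open_nbhs_nbhs.
    by split; [exact: open_neq|exact: utk].
  move=> near_t; near=> v; have [->//|vu] := eqVneq v u.
  rewrite /w; case: existsP => // -[k /eqP vt].
  have vt' : forall k, v != u -> v != t k by apply: (near near_t v).
  by move/eqP: (vt' k vu).
have wnz : exists2 z : 'I_n.+1 -> R, injective z &
    forall k, a <= z k <= b /\ w (z k) != 0.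
  exists t; first exact: separates_inj yt.
  by move=> k; split=> //; rewrite wt invr_eq0 gt_eqF.
have wle z : (forall k, gpoly r z (t k) <= gpoly r y (t k)) ->
    wmax r a b w z <= 1.
  move=> zy; have [_ _ [u uab <-]] := wmaxP r0 ab uscw (fun u _ => w0 u) z.
  rewrite /w; case: existsP => [[k /eqP ->]|_]; last by rewrite mul0r ler01.
  by rewrite mulrC ler_pdivrMr// mul1r.
have ext_eq z : extremizer r a b w z -> z = y.
  move=> zext.
  have [t' zt' t'P] := extremizer_separates uscw (fun u _ => w0 u) wnz zext.
  have /(extremizerP r0 ab uscw (fun u _ => w0 u))[_ zmin] := zext.
  have /choice[f ft] k : exists l, t' k = t l.
    have := wmax_gt0 r0 ab uscw (fun u _ => w0 u) wnz z; rewrite -(t'P k).2 /w.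
    by case: existsP => [[l /eqP ->] _|]; [exists l|rewrite mul0r ltxx].
  (* t' is an increasing family of n + 1 points among the n + 1 points t_k. *)
  have f_id : f =1 id.
    apply: ord_ltn_homo_id => k l /(separates_lt zt').
    rewrite !ft; apply: contraTT; rewrite -leqNgt -leNgt leq_eqVlt.
    by case/orP => [/eqP/val_inj ->//|/(separates_lt yt)/ltW].
  have zt : separates z t by move=> k i; have := zt' k i; rewrite ft f_id.
  apply: contrapT => zy.
  have [k] := gpoly_lt_separates r0 zt yt (nesym zy).
  rewrite ltNge => /negP[].
  have := (t'P k).2; rewrite ft f_id wt => zE.
  have : (gpoly r y (t k))^-1 * gpoly r z (t k) <= 1.
    by rewrite zE (le_trans (zmin _ yN))// wle.
  by rewrite mulrC ler_pdivrMr// mul1r.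
have [z zext] := extremizer_exists r0 ab uscw (fun u _ => w0 u).
have := zext; rewrite (ext_eq _ zext) => yext.
have /(extremizerP r0 ab uscw (fun u _ => w0 u))[_ ymin] := yext.
apply: ext_eq; apply/(extremizerP r0 ab uscw (fun u _ => w0 u)); split=> //.
have y1 : 1 <= wmax r a b w y.
  have [_ /(_ _ (tab ord0)) + _] := wmaxP r0 ab uscw (fun u _ => w0 u) y.
  by rewrite wt mulVf ?gt_eqF.
by move=> v /ymin; apply: le_trans; rewrite (le_trans _ y1)// wle.
Unshelve. all: by end_near. Qed.

End Uniqueness.

Section Minimax.
Variables (R : realType) (n : nat) (r : 'I_n -> R) (a b : R) (w : R -> R).
Hypotheses (r0 : forall i, 0 < r i) (ab : a < b) (uscw : usc_on `[a, b] w).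
Hypothesis (w0 : forall u, a <= u <= b -> 0 <= w u).
Hypothesis wnz : exists2 z : 'I_n.+1 -> R, injective z &
  forall k, a <= z k <= b /\ w (z k) != 0.

(** The weight is positive at the points t_k, so comparing norms compares T_x
and T_y there. *)
Lemma equioscillates_eq x y :
    node_systems a b x -> node_systems a b y -> equioscillates r a b w y ->
    wmax r a b w x <= wmax r a b w y ->
  x = y.
Proof.
move=> xN yN [t [/(interlacing_separates _ yN)[yt tab] tE]] xy.
apply: (gpoly_le_eq r0 ab xN yN yt tab) => k.
have [_ /(_ _ (tab k)) xk _] := wmaxP r0 ab uscw w0 x.
have [yE _ _] := wmaxP r0 ab uscw w0 y.
have {}tE : w (t k) * gpoly r y (t k) = wmax r a b w y.
  by apply: EFin_inj; rewrite tE.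
have wt0 : 0 < w (t k).
  rewrite lt_neqAle w0// andbT eq_sym; apply/eqP => wt.
  have := wmax_gt0 r0 ab uscw w0 wnz y.
  by rewrite -tE wt mul0r ltxx.
by rewrite -(ler_pM2l wt0) tE (le_trans xk).
Qed.

Lemma strict_nodes_separates x (t : 'I_n.+1 -> R) :
  separates x t -> (forall k, a <= t k <= b) -> strict_nodes a b x.
Proof.
move=> xt tab; split=> [i|i j ij].
  have /andP[at0 _] := tab ord0; have /andP[_ tnb] := tab ord_max.
  apply/andP; split; first by apply: le_lt_trans at0 _; apply xt.
  by apply: lt_le_trans tnb; apply xt => /=.
by apply: (@lt_trans _ _ (t (widen_ord (leqnSn n) j))); apply xt => /=.
Qed.

Lemma minimax : exists x : 'I_n -> R,
    [/\ unique (extremizer r a b w) x,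
        strict_nodes a b x &
        unique (fun y => node_systems a b y /\ equioscillates r a b w y) x].
Proof.
have [x xext] := extremizer_exists r0 ab uscw w0; exists x.
have [t xt tP] := extremizer_separates r0 ab uscw w0 wnz xext.
have tab k := (tP k).1.
have [xN xmin] := (extremizerP r0 ab uscw w0 x).1 xext.
have xosc : equioscillates r a b w x.
  exists t; split; first exact/(interlacing_separates _ xN).
  by move=> k; rewrite (tP k).2; have [-> _ _] := wmaxP r0 ab uscw w0 x.
split; last 1 first.
- split=> // y [yN yosc].
  by apply: equioscillates_eq => //; exact: xmin.
- split=> // y /(extremizerP r0 ab uscw w0)[yN ymin].
  by apply/esym/equioscillates_eq => //; exact: ymin.
exact: strict_nodes_separates xt tab.
Qed.

End Minimax.

Lemma enough_nonzeros_family (R : realType) n (a b : R) (w : R -> R) :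
  enough_nonzeros n a b w ->
  exists2 z : 'I_n.+1 -> R, injective z &
    forall k, a <= z k <= b /\ w (z k) != 0.
Proof.
move=> [z [z0 [zI zP z0P zz0]]].
exists (fun k => oapp z z0 (unlift ord0 k)).
  move=> k l; case: unliftP => [i ->|->]; case: unliftP => [j ->|->] //=.
  - by move/zI ->.
  - by move/eqP; rewrite (negbTE (zz0 i)).
  - by move/esym/eqP; rewrite (negbTE (zz0 j)).
move=> k; case: unliftP => [i _|_] //=.
by have [/andP[azi zib] wz] := zP i; rewrite !ltW.
Qed.

Theorem theorem1p2 (R : realType) (n : nat) (r : 'I_n -> R) (a b : R)
    (w : R -> R)
    (hr : forall i, 0 < r i)
    (hab : a < b)
    (hw_usc : usc_on `[a, b] w)
    (hw_ge0 : forall u, a <= u <= b -> 0 <= w u)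
    (hw_nz : enough_nonzeros n a b w) :
  exists x : 'I_n -> R,
    [/\ unique (extremizer r a b w) x,
        strict_nodes a b x &
        unique (fun y => node_systems a b y /\ equioscillates r a b w y) x].
Proof.
exact: minimax (enough_nonzeros_family hw_nz).
Qed.
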